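(* There exists a streaming certification scheme for $\mathrm{Diameter}_{\geq}$ in which the certificate size is $O(n\log k)$ bits and the verifier's space complexity is $O(\log n)$ bits, for all $n$-node graphs and thresholds $k\geq 1$.
   Context: $\mathrm{Diameter}_{\geq}$ takes as input a graph $G$ and a threshold $k$ and asks whether the diameter of $G$ (the maximum over pairs of vertices of their shortest-path distance) is at least $k$. Inputs: an $n$-node graph on $[n]$ and threshold $k$; $k$ is given first, then the edges arrive as a stream in an arbitrary, possibly adversarial, order. A streaming certification scheme for a decision problem $P$ consists of a prover (a computationally unlimited function producing a certificate $c\in\{0,1\}^*$ depending only on the input, not on the edge order) and a verifier (a deterministic streaming algorithm with read-only access to $c$ that processes the stream and outputs accept or reject). Completeness: if the input satisfies $P$, some certificate makes the verifier accept for every edge order. Soundness: if the input does not satisfy $P$, the verifier rejects for every certificate and every edge order. The verifier's space complexity excludes the read-only certificate. *)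

(* Defs.v *)
From HB Require Import structures.
From mathcomp Require Import all_boot.

Set Implicit Arguments.
Unset Strict Implicit.
Unset Printing Implicit Defensive.

(** * Graphs on [n], distance and diameter *)

Record sgraph (n : nat) := SGraph {
  adj :> rel 'I_n;
  adj_sym : symmetric adj;
  adj_irr : irreflexive adj
}.

Definition edges n (G : sgraph n) : {set {set 'I_n}} :=
  [set [set e.1; e.2] | e : 'I_n * 'I_n & G e.1 e.2].

Definition has_walk n (G : sgraph n) (u v : 'I_n) (m : nat) : bool :=
  [exists p : m.-tuple 'I_n, path G u p && (last u p == v)].

Lemma connect_walk n (G : sgraph n) (u v : 'I_n) :
  connect G u v -> exists m, has_walk G u v m.
Proof.
case/connectP=> p Gp ->; exists (size p).
by apply/existsP; exists (in_tuple p); rewrite /= Gp eqxx.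
Qed.

(** Distances and diameters live in [option nat], with [None] for infinity:
    vertices in different components are at infinite distance. *)
Definition dist n (G : sgraph n) (u v : 'I_n) : option nat :=
  match @idP (connect G u v) with
  | ReflectT uv => Some (ex_minn (connect_walk uv))
  | ReflectF _ => None
  end.

Definition emax (a b : option nat) : option nat :=
  if a is Some x then if b is Some y then Some (maxn x y) else None else None.

Definition leqe (k : nat) (a : option nat) : bool :=
  if a is Some x then k <= x else true.

Definition diameter n (G : sgraph n) : option nat :=
  \big[emax/Some 0]_(u : 'I_n) \big[emax/Some 0]_(v : 'I_n) dist G u v.

Definition problem := forall n : nat, sgraph n -> nat -> Prop.

Definition diameter_geq : problem := fun n G k => leqe k (diameter G).

(** [s] lists every edge of [G] exactly once; both the order of the edges and
    the order of the two endpoints within each item are arbitrary. *)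
Definition edge_stream n (G : sgraph n) (s : seq ('I_n * 'I_n)) : bool :=
  perm_eq [seq [set e.1; e.2] | e <- s] (enum (edges G)).

(** * Streaming verifiers

    At each step the current memory content alone determines the action: read
    one bit of the certificate at some address, consume the next stream item,
    or output an answer.  The memory content after a read depends only on the
    previous one and on the symbol read, so that everything the verifier
    remembers, within the processing of one stream item as well as between two
    items, is charged to its space.  Reading past the end of the certificate or
    of the stream yields [None].  As usual for streaming algorithms, [n] is
    known in advance and only memory is accounted for. *)
Inductive action (n : nat) (M : Type) :=
  | Query of nat & (option bool -> M)
  | Next of (option ('I_n * 'I_n) -> M)
  | Output of bool.

(** [start k] is the memory content once the first item, the threshold [k],
    has been received. *)
Record verifier (n : nat) := Verifier {
  memory : finType;
  start : nat -> memory;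
  act : memory -> action n memory
}.

(** Number of bits needed to store a memory content. *)
Definition space n (V : verifier n) : nat := up_log 2 #|memory V|.

Fixpoint run n (V : verifier n) (c : bitseq) (t : nat) (m : memory V)
    (s : seq ('I_n * 'I_n)) : option bool :=
  if t is t'.+1 then
    match act m with
    | Query a f => run c t' (f (onth c a)) s
    | Next f => run c t' (f (ohead s)) (behead s)
    | Output b => Some b
    end
  else None.

Definition outputs n (V : verifier n) (c : bitseq) (k : nat)
    (s : seq ('I_n * 'I_n)) (b : bool) : Prop :=
  exists t, run c t (start V k) s = Some b.

Definition accepts n (V : verifier n) c k s := outputs V c k s true.
Definition rejects n (V : verifier n) c k s := outputs V c k s false.

(** * Streaming certification schemes *)

Record scheme := Scheme {
  prover : forall n : nat, sgraph n -> nat -> bitseq;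
  verif : forall n : nat, verifier n
}.

Definition halting (S : scheme) : Prop :=
  forall n (G : sgraph n) k c s, 0 < k -> edge_stream G s ->
  accepts (verif S n) c k s \/ rejects (verif S n) c k s.

Definition completeness (P : problem) (S : scheme) : Prop :=
  forall n (G : sgraph n) k, 0 < k -> P n G k ->
  forall s, edge_stream G s -> accepts (verif S n) (prover S G k) k s.

Definition soundness (P : problem) (S : scheme) : Prop :=
  forall n (G : sgraph n) k, 0 < k -> ~ P n G k ->
  forall c s, edge_stream G s -> rejects (verif S n) c k s.

Definition certification_scheme (P : problem) (S : scheme) : Prop :=
  [/\ halting S, completeness P S & soundness P S].

(** Integer part of the binary logarithm: it is 0 at 1 like the logarithm
    itself, and from 2 on it lies between half the logarithm and the logarithm,
    so it yields the same [O] bounds. *)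
Definition log2 (n : nat) : nat := trunc_log 2 n.

(* Main.v *)
Require Import Defs.
From HB Require Import structures.
From mathcomp Require Import all_boot.
From mathcomp Require Import zify.

Set Implicit Arguments.
Unset Strict Implicit.
Unset Printing Implicit Defensive.

(** The certificate lists, for a vertex [u] of eccentricity at least [k], the
    distances from [u] capped at [k], in binary with a fixed width.  If the
    labels of the endpoints of every edge differ by at most one, and the labels
    [0] and [k] both occur, then a walk from a vertex labelled [0] to a vertex
    labelled [k] has at least [k] edges.  Only two labels need to be in memory
    at a time.  Finite distances are smaller than [n], so [k] may be replaced
    with [minn k n], which fits in [O(log n)] bits. *)

(** * Distances, the diameter threshold and capped distances *)

Lemma leqe_emax k a b : leqe k (emax a b) = leqe k a || leqe k b.
Proof. by case: a b => [x|] [y|] //=; rewrite ?orbT // leq_max. Qed.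

(** For [0 < k], [leqe k] maps [emax] to disjunction and the initial value [Some 0] to false, so
    both big maxima become existentials. *)
Lemma diameter_geqE n (G : sgraph n) k : 0 < k ->
  leqe k (diameter G) = [exists u, exists v, leqe k (dist G u v)].
Proof.
move=> k0; have l0 : leqe k (Some 0) = false by rewrite /= leqNgt k0.
rewrite (big_morph (leqe k) (leqe_emax k) l0) big_orE.
by apply: eq_existsb => u; rewrite (big_morph (leqe k) (leqe_emax k) l0) big_orE.
Qed.

Lemma walk_connect n (G : sgraph n) u v m : has_walk G u v m -> connect G u v.
Proof.
by case/existsP=> p /andP[Gp /eqP<-]; apply/connectP; exists p.
Qed.

Variant dist_spec n (G : sgraph n) u v : option nat -> Set :=
  | DistSome m of has_walk G u v m & (forall m', has_walk G u v m' -> m <= m')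
      : dist_spec G u v (Some m)
  | DistNone of (forall m, ~~ has_walk G u v m) : dist_spec G u v None.

Lemma distP n (G : sgraph n) u v : dist_spec G u v (dist G u v).
Proof.
(* [dist] matches on a reflection proof that also occurs in its result; abstracting both proofs
   makes the case analysis possible. *)
have dist_match (P : Prop) (b : bool) (r : reflect P b)
    (cw : P -> exists m, has_walk G u v m) :
    (forall m, has_walk G u v m -> P) ->
    dist_spec G u v (match r with
                     | ReflectT uv => Some (ex_minn (cw uv))
                     | ReflectF _ => None end).
  case: r => [uv|nuv] wc.
    by case: ex_minnP => m Wm min_m; constructor.
  by constructor=> m; apply/negP => /wc.
exact: dist_match (@walk_connect _ G u v).
Qed.

Lemma leqe_distP n (G : sgraph n) u v k :
  reflect (forall m, has_walk G u v m -> k <= m) (leqe k (dist G u v)).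
Proof.
case: distP => [m Wm min_m|noW] /=.
  by apply: (iffP idP) => [km m' /min_m|]; [apply: leq_trans | apply].
by constructor=> m; rewrite (negPf (noW m)).
Qed.

(** A shortest walk is no longer than a path without repeated vertices, which has at most [n]
    vertices. *)
Lemma dist_ltn n (G : sgraph n) u v m : dist G u v = Some m -> m < n.
Proof.
case: distP => // {}m Wm min_m [<-].
case/connectP: (walk_connect Wm) => p Gp vE.
case/shortenP: Gp vE => p' Gp' Up' _ vE.
have : m <= size p'.
  by apply: min_m; apply/existsP; exists (in_tuple p'); rewrite /= Gp' vE eqxx.
move/leq_ltn_trans; apply; rewrite -[n in _ < n]card_ord.
by rewrite -[(size p').+1]/(size (u :: p')) -(card_uniqP Up') max_card.
Qed.

Lemma leqe_minn n (G : sgraph n) u v k :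
  leqe (minn k n) (dist G u v) = leqe k (dist G u v).
Proof.
by case E: dist => [m|] //=; move/dist_ltn: E; rewrite geq_min => mn; lia.
Qed.

(** Unreachable vertices get label [k], so disconnected graphs need no separate treatment. *)
Definition capped k (d : option nat) := if d is Some m then minn m k else k.

Lemma dist_refl n (G : sgraph n) u : dist G u u = Some 0.
Proof.
have W : has_walk G u u 0 by apply/existsP; exists [tuple]; rewrite /= eqxx.
case: distP => [m _ /(_ _ W)|/(_ 0)]; last by rewrite W.
by rewrite leqn0 => /eqP->.
Qed.

Lemma capped_dist_adj n (G : sgraph n) k u a b :
  G a b -> capped k (dist G u b) <= (capped k (dist G u a)).+1.
Proof.
move=> Gab; case: (distP G u a) => [m Wm _|_] /=; last first.
  by case: dist => [x|] /=; rewrite ?(leqW, geq_minr).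
have Wb : has_walk G u b m.+1.
  case/existsP: Wm => p /andP[Gp /eqP pa].
  apply/existsP; exists [tuple of rcons p b].
  by rewrite /= rcons_path Gp last_rcons pa Gab eqxx.
case: distP => [m' _ /(_ _ Wb)|/(_ m.+1)] /=; last by rewrite Wb.
by lia.
Qed.

(** * Labellings that vary by at most one along each edge *)

Lemma edge_stream_all n (G : sgraph n) s (r : rel 'I_n) :
  reflexive r -> symmetric r -> edge_stream G s ->
  all (fun e => r e.1 e.2) s <-> (forall a b, G a b -> r a b).
Proof.
move=> rr rs /perm_mem sE.
(* The stream may orient an edge either way, which symmetry absorbs; reflexivity settles the cases
   where [a] and [b] are the same endpoint. *)
have r_set2 x y a b : [set x; y] = [set a; b] -> r x y -> r a b.
  move=> eq_xy rxy.
  have := set21 a b; have := set22 a b; rewrite -eq_xy.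
  by move=> /set2P[]-> /set2P[]-> //; rewrite rs.
split=> [/allP r_s a b Gab|rG].
  have : [set a; b] \in [seq [set e.1; e.2] | e <- s].
    by rewrite sE mem_enum; apply/imsetP; exists (a, b); rewrite ?inE.
  by case/mapP=> e /r_s re /esym/r_set2; apply.
apply/allP=> e es.
have : [set e.1; e.2] \in enum (edges G).
  by rewrite -sE; apply/mapP; exists e.
by rewrite mem_enum => /imsetP[[a b] /[!inE] /rG rab /esym/r_set2]; apply.
Qed.

Definition near (x y : nat) := (x <= y.+1) && (y <= x.+1).

Lemma near_path n (G : sgraph n) (l : 'I_n -> nat) u p :
  (forall a b, G a b -> near (l a) (l b)) -> path G u p ->
  l (last u p) <= l u + size p.
Proof.
move=> nG; elim: p u => [|x p IHp] u /=; first by rewrite addn0.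
case/andP=> /nG /andP[_ lx] /IHp; lia.
Qed.

Lemma near_diameter n (G : sgraph n) (l : 'I_n -> nat) k u v :
  (forall a b, G a b -> near (l a) (l b)) -> l u = 0 -> l v = k ->
  leqe k (dist G u v).
Proof.
move=> nG lu lv; apply/leqe_distP => m /existsP[p /andP[Gp /eqP pv]].
by have := near_path nG Gp; rewrite pv lu lv size_tuple.
Qed.

(** * Memory and transitions of the verifier *)

Definition word n : finType := 'I_(n.+1.*2).+1.

(* The threshold, the number of vertices still to be scanned, the number of
   bits read for the current pair, this pair, the labels of its two vertices as
   read so far, and three flags: label 0 seen, threshold seen, no edge violated
   so far.  The left summand holds the final answer. *)
Definition state n : finType :=
  (bool + word n * word n * word n * ('I_n.+1 * 'I_n.+1) * (word n * word n)
    * (bool * bool * bool))%type.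

Definition width k := (log2 k).+1.

(** Bits arrive most significant first, and a missing bit counts as 0. On overflow [inord] returns
    0, which is harmless: soundness holds for any labels, as long as each vertex always gets the
    same one. *)
Definition push n (x : word n) (o : option bool) : word n :=
  inord (x.*2 + odflt false o).

Fixpoint prefix n (c : bitseq) w (v : nat) j : word n :=
  if j is i.+1 then push (prefix n c w v i) (onth c (v * w + i)) else ord0.

(** Testing 0 only on the first label and [k] only on the second suffices, since every vertex is
    also presented as a loop. *)
Definition judge k (fl : bool * bool * bool) (x y : nat) :=
  let: (z, t, ok) := fl in (z || (x == 0), t || (y == k), ok && near x y).

Definition verdict (fl : bool * bool * bool) :=
  let: (z, t, ok) := fl in [&& z, t & ok].

Definition load n (k i : word n) (e : 'I_n.+1 * 'I_n.+1) fl : state n :=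
  inr (k, i, ord0, e, (ord0, ord0), fl).

(* The scan for the labels 0 and k treats each vertex v as a loop (v, v), so that
   it shares the code processing the edges; the [Query n.+1 0] there is an
   internal move, whose answer is ignored. *)
Definition step n (m : state n) : action n.+1 (state n) :=
  match m with
  | inl b => Output _ _ b
  | inr (k, i, j, (a, b), (x, y), fl) =>
    let w := width k in
    if j < w then
      Query n.+1 (a * w + j)
        (fun o => inr (k, i, inord j.+1, (a, b), (push x o, y), fl))
    else if j < w.*2 then
      Query n.+1 (b * w + (j - w))
        (fun o => inr (k, i, inord j.+1, (a, b), (x, push y o), fl))
    else
      let fl' := judge k fl x y in
      if nat_of_ord i is i'.+1 then
        Query n.+1 0 (fun=> load k (inord i') (inord i', inord i') fl')
      else
        Next (fun o => if o is Some e then load k i e fl' else inl (verdict fl'))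
  end.

Definition threshold n k := minn k n.

(* At threshold 1 the certificate has to be empty, since log2 1 = 0; with at
   least two vertices the answer is then always positive. *)
Definition first_state n k : state n :=
  let K := threshold n.+1 k in
  if 1 < K then
    load (inord K) (inord n.+1) (ord0, ord0) (false, false, true)
  else inl true.

Definition machine n : verifier n.+1 := Verifier (@first_state n) (@step n).

(** * Runs of the verifier *)

Definition yields n (V : verifier n) c (m : memory V) s b :=
  exists t, run c t m s = Some b.

Lemma yields_step n (V : verifier n) c (m : memory V) s b :
  match act m with
  | Query a f => yields c (f (onth c a)) s b
  | Next f => yields c (f (ohead s)) (behead s) b
  | Output b' => b' = b
  end -> yields c m s b.
Proof.
case E: (act m) => [a f|f|b']; last by move=> <-; exists 1; rewrite /= E.
  by case=> t ft; exists t.+1; rewrite /= E.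
by case=> t ft; exists t.+1; rewrite /= E.
Qed.

Lemma width_leq k : 0 < k -> width k <= k.
Proof.
by move=> k0; apply: leq_trans (trunc_logP (leqnn 2) k0); apply: ltn_expl.
Qed.

(** The memory after [j] of the [2w] bits of a pair; [minn] and truncated subtraction let one
    formula cover both blocks. *)
Definition reading n (k i : word n) (e : 'I_n.+1 * 'I_n.+1) fl c j : state n :=
  let w := width k in
  inr (k, i, inord j, e,
       (prefix n c w e.1 (minn j w), prefix n c w e.2 (j - w)), fl).

Lemma yields_read n (k i : word n) e fl c s b j :
  0 < k <= n.+1 -> j <= (width k).*2 ->
  yields (V := machine n) c (reading k i e fl c (width k).*2) s b ->
  yields (V := machine n) c (reading k i e fl c j) s b.
Proof.
move=> /andP[k0 kn] jw Y.
(* So the bit counter, at most [2 * width k], fits in [word n]. *)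
have wn : width k <= n.+1 by apply: leq_trans (width_leq k0) kn.
(* Induction on the number [d] of bits still to be read. *)
have [d dE] : exists d, j + d = (width k).*2 by exists ((width k).*2 - j); lia.
elim: d j {jw} dE => [|d IHd] j dE; first by rewrite -dE addn0 in Y.
have jK : (inord j : word n) = j :> nat by rewrite inordK //; lia.
have /IHd {IHd Y} : j.+1 + d = (width k).*2 by lia.
have jw2 : j < (width k).*2 by lia.
rewrite /reading; case: e => a b'; move wE: (width k) jw2 => w jw2.
have [jw|wj] := ltnP j w.
  have -> : minn j.+1 w = j.+1 by lia.
  have -> : j.+1 - w = 0 by lia.
  have -> : j - w = 0 by lia.
  by move=> Y; apply: yields_step; rewrite /= wE jK jw.
have -> : minn j.+1 w = w by lia.
have -> : j.+1 - w = (j - w).+1 by lia.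
by move=> Y; apply: yields_step; rewrite /= wE jK ltnNge wj jw2.
Qed.

Definition items n (s : seq ('I_n.+1 * 'I_n.+1)) i :=
  [seq (inord x, inord x) | x <- rev (iota 0 i)] ++ s.

Lemma itemsS n (s : seq ('I_n.+1 * 'I_n.+1)) i :
  items s i.+1 = (inord i, inord i) :: items s i.
Proof. by rewrite /items -[i.+1]addn1 iotaD rev_cat. Qed.

Definition label n c k (v : 'I_n.+1) : word n := prefix n c (width k) v (width k).

Definition judge_labels n c k fl (e : 'I_n.+1 * 'I_n.+1) :=
  judge k fl (label c k e.1) (label c k e.2).

Lemma yields_load n (k i : word n) e fl c s b :
  0 < k <= n.+1 ->
  yields (V := machine n) c
    (inr (k, i, inord (width k).*2, e, (label c k e.1, label c k e.2), fl)) s b ->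
  yields (V := machine n) c (load k i e fl) s b.
Proof.
move=> k0; rewrite [load _ _ _ _](_ : _ = reading k i e fl c 0).
  move=> Y; apply: yields_read => //; rewrite /reading.
  have -> : minn (width k).*2 (width k) = width k by lia.
  by have -> : (width k).*2 - width k = width k by lia.
rewrite /reading min0n sub0n /load; congr (inr (_, _, _, _, _, _)).
by apply: val_inj; rewrite /= inordK.
Qed.

(** The pair in memory is judged only when the next item is requested, hence [e :: s]. *)
Lemma yields_stream n (k : word n) e fl c s : 0 < k <= n.+1 ->
  yields (V := machine n) c (load k ord0 e fl) s
    (verdict (foldl (judge_labels c k) fl (e :: s))).
Proof.
have wle : width k <= (width k).*2 by lia.
move=> k0; have wK : (inord (width k).*2 : word n) = (width k).*2 :> nat.
  by rewrite inordK //; have := @width_leq k; lia.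
elim: s e fl => [|e' s IHs] e fl; apply: yields_load => //;
  case: e => a b; apply: yields_step;
  rewrite /= wK ltnn ltnNge wle //=.
by apply: yields_step.
Qed.

Lemma yields_scan n (k : word n) i e fl c s : 0 < k <= n.+1 -> i <= n.+1 ->
  yields (V := machine n) c (load k (inord i) e fl) s
    (verdict (foldl (judge_labels c k) fl (e :: items s i))).
Proof.
have wle : width k <= (width k).*2 by lia.
move=> k0; have wK : (inord (width k).*2 : word n) = (width k).*2 :> nat.
  by rewrite inordK //; have := @width_leq k; lia.
elim: i e fl => [|i IHi] e fl i_n.
  suff -> : inord 0 = ord0 :> word n by apply: yields_stream.
  by apply: val_inj; rewrite /= inordK.
have iK : (inord i.+1 : word n) = i.+1 :> nat by rewrite inordK //; lia.
rewrite itemsS; apply: yields_load => //; case: e => a b; apply: yields_step.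
rewrite /= wK ltnn ltnNge wle /= iK.
by apply: IHi; lia.
Qed.

(** * Acceptance expressed through the labels *)

Lemma foldl_judge n c k z t ok (s : seq ('I_n.+1 * 'I_n.+1)) :
  foldl (judge_labels c k) (z, t, ok) s =
    (z || has (fun e => label c k e.1 == 0 :> nat) s,
     t || has (fun e => label c k e.2 == k :> nat) s,
     ok && all (fun e => near (label c k e.1) (label c k e.2)) s).
Proof.
elim: s z t ok => [|e s IHs] z t ok /=; first by rewrite !orbF andbT.
by rewrite IHs -!orbA -andbA.
Qed.

Lemma mem_items n (s : seq ('I_n.+1 * 'I_n.+1)) v : (v, v) \in items s n.+1.
Proof.
rewrite mem_cat; apply/orP; left; apply/mapP; exists (val v).
  by rewrite mem_rev mem_iota /= add0n ltn_ord.
by rewrite inord_val.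
Qed.

Lemma all_items n (s : seq ('I_n.+1 * 'I_n.+1)) (r : rel 'I_n.+1) i :
  reflexive r -> all (fun e => r e.1 e.2) (items s i) = all (fun e => r e.1 e.2) s.
Proof.
move=> rr; rewrite all_cat; have -> // : all (fun e => r e.1 e.2)
  [seq (inord x, inord x) | x <- rev (iota 0 i)].
by apply/allP=> _ /mapP[x _ ->] /=.
Qed.

Lemma near_refl (l : nat) : near l l.
Proof. by rewrite /near; lia. Qed.

Definition accepting n (G : sgraph n.+1) k (l : 'I_n.+1 -> nat) :=
  [/\ exists u, l u = 0, exists v, l v = k & forall a b, G a b -> near (l a) (l b)].

(** An exact characterisation for every certificate, from which both soundness and completeness
    follow. *)
Lemma yields_machine n (G : sgraph n.+1) k c s : edge_stream G s ->
  1 < threshold n.+1 k ->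
  exists2 b, outputs (machine n) c k s b &
    (b <-> accepting G (threshold n.+1 k) (label c (threshold n.+1 k))).
Proof.
set K := threshold _ _ => sG K1; have Kn : K <= n.+1 by apply: geq_minr.
have KK : (inord K : word n) = K :> nat by rewrite inordK //; lia.
have [|t] := @yields_scan n (inord K) n.+1 (ord0, ord0) (false, false, true) c s _
  (leqnn _); first by rewrite KK; lia.
rewrite KK foldl_judge => runE; set b := verdict _ in runE.
exists b; first by exists t; rewrite /= /first_state -/K K1.
set l := label c K.
have nearS : symmetric (fun u v => near (l u) (l v)).
  by move=> u v; rewrite /near andbC.
have nearE := edge_stream_all (fun u => near_refl (l u)) nearS sG.
have itemsE := all_items s n.+1 (r := fun u v => near (l u) (l v))
  (fun u => near_refl (l u)).
(* The leading loop at [ord0] is the pair loaded initially; it satisfies [near] and is scanned again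
   among the items. *)
have -> : b = [&& has (fun e => l e.1 == 0 :> nat) ((ord0, ord0) :: items s n.+1),
    has (fun e => l e.2 == K :> nat) ((ord0, ord0) :: items s n.+1)
    & all (fun e => near (l e.1) (l e.2)) s].
  by rewrite -itemsE /b /verdict /= near_refl.
split.
  case/and3P=> /hasP[e _ /eqP l0] /hasP[e' _ /eqP lK] /nearE lG.
  by split; [exists e.1 | exists e'.2 |].
case=> [[u lu] [v lv] /nearE lG]; apply/and3P; split=> //; apply/hasP.
  by exists (u, u); [rewrite inE mem_items orbT | rewrite /= lu].
by exists (v, v); [rewrite inE mem_items orbT | rewrite /= lv].
Qed.

(** * The honest certificate *)

Definition encode n k (l : 'I_n.+1 -> nat) : bitseq :=
  let w := width k in
  mkseq (fun i => odd (l (inord (i %/ w)) %/ 2 ^ (w.-1 - i %% w))) (n.+1 * w).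

Lemma ltn_expn_width k : k < 2 ^ width k.
Proof. exact: trunc_log_ltn. Qed.

Lemma label_encode n k (l : 'I_n.+1 -> nat) v : 0 < k <= n.+1 ->
  (forall u, l u <= k) -> label (encode k l) k v = l v :> nat.
Proof.
case/andP=> k0 kn lk; rewrite /label; set w := width k.
(* After [j] bits the register holds the top [j] of the [w] bits of [l v]; being at most [k], it
   never overflows. *)
suff prefixE j : j <= w -> prefix n (encode k l) w v j = l v %/ 2 ^ (w - j) :> nat.
  by rewrite prefixE // subnn divn1.
elim: j => [|j IHj] jw /=.
  by rewrite subn0 divn_small // (leq_ltn_trans (lk v)) ?ltn_expn_width.
have vw : v * w + j < n.+1 * w.
  rewrite -addnS; apply: leq_trans (_ : v * w + w <= _); first by rewrite leq_add2l.
  by rewrite -mulSnr leq_mul2r ltn_ord orbT.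
have bitE : odflt false (onth (encode k l) (v * w + j)) =
    odd (l v %/ 2 ^ (w - j.+1)).
  rewrite odflt_onth nth_mkseq // divnMDl // (divn_small jw) addn0 inord_val.
  by rewrite modnMDl modn_small // subnS -subn1 subnAC subn1.
rewrite /push IHj ?(ltnW jw) // bitE (_ : w - j = (w - j.+1).+1); last by lia.
rewrite expnSr divnMA divn2 addnC odd_double_half inordK //.
have := leq_div (l v) (2 ^ (w - j.+1)); have := lk v; lia.
Qed.

Definition certificate n (G : sgraph n.+1) k : bitseq :=
  let K := threshold n.+1 k in
  if 1 < K then
    if [pick u | [exists v, leqe K (dist G u v)]] is Some u then
      encode K (fun v => capped K (dist G u v))
    else [::]
  else [::].

(** * Correctness of the scheme *)

Lemma diameter_geq_threshold n (G : sgraph n) k : 0 < k ->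
  diameter_geq G k <-> exists u v, leqe (threshold n k) (dist G u v).
Proof.
move=> k0; rewrite /diameter_geq diameter_geqE //; split.
  by case/existsP=> u /existsP[v]; rewrite -leqe_minn; exists u, v.
by case=> u [v]; rewrite leqe_minn => uv;
  apply/existsP; exists u; apply/existsP; exists v.
Qed.

Lemma machine_correct n (G : sgraph n.+2) k c s : 0 < k -> edge_stream G s ->
  exists2 b, outputs (machine n.+1) c k s b &
    (b -> diameter_geq G k) /\ (diameter_geq G k -> c = certificate G k -> b).
Proof.
move=> k0 sG; have [PE EP] := diameter_geq_threshold G k0.
suff [b Yb [bE Eb]] : exists2 b, outputs (machine n.+1) c k s b &
    (b -> exists u v, leqe (threshold n.+2 k) (dist G u v)) /\
    ((exists u v, leqe (threshold n.+2 k) (dist G u v)) ->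
      c = certificate G k -> b).
  by exists b => //; split=> [/bE /EP|/PE /Eb].
have [K1|K1] := ltnP 1 (threshold n.+2 k); last first.
  (* The first and last of at least two vertices are distinct, so their distance is not 0. *)
  exists true; first by exists 1; rewrite /= /first_state ltnNge K1.
  split=> // _; exists ord0, ord_max; case: distP => //= -[|m] W _; last first.
    exact: leq_trans K1 _.
  by case/existsP: W => p; rewrite (tuple0 p).
have [b Yb bE] := yields_machine c sG K1; exists b => //; have [bl lb] := bE; split.
  case/bl=> -[u lu] [v lv] lG; exists u, v.
  exact: (@near_diameter _ _ (label c (threshold n.+2 k)) _ _ _ lG lu lv).
set K := threshold _ _ in K1 lb * => -[u0 [v0 uv0]] cE; apply: lb; move: cE => ->.
rewrite /certificate -/K K1; case: pickP => [u /existsP[v uv]|/(_ u0)]; last first.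
  by move/existsP=> []; exists v0.
have lE w : label (encode K (fun v => capped K (dist G u v))) K w
    = capped K (dist G u w) :> nat.
  rewrite label_encode // => [|x]; first by rewrite geq_minr (ltnW K1).
  by case: dist => //= m; apply: geq_minr.
split.
- by exists u; rewrite lE dist_refl /= min0n.
- by exists v; rewrite lE; case: dist uv => //= m; apply/minn_idPr.
- move=> a b' Gab; rewrite !lE /near !capped_dist_adj //.
  by rewrite adj_sym.
Qed.

Definition rejecting n : verifier n := Verifier (fun=> tt) (fun=> Output n unit false).

(* For n <= 1 the bound on the space leaves a single memory state. *)
Definition diameter_scheme := Scheme
  (fun n => if n is n'.+2 return sgraph n -> nat -> bitseq
            then @certificate n'.+1 else fun _ _ => [::])
  (fun n => if n is n'.+2 return verifier n then machine n'.+1 else rejecting _).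

Lemma diameter_geq_small n (G : sgraph n) k : n <= 1 -> 0 < k -> ~ diameter_geq G k.
Proof.
move=> n1 k0 /(diameter_geq_threshold _ k0)[u [v]]; rewrite leqe_minn.
have -> : v = u by apply: ord_inj; have := ltn_ord u; have := ltn_ord v; lia.
by rewrite dist_refl /= leqNgt k0.
Qed.

Lemma scheme_correct n (G : sgraph n) k c s : 0 < k -> edge_stream G s ->
  exists2 b, outputs (verif diameter_scheme n) c k s b &
    (b -> diameter_geq G k) /\
    (diameter_geq G k -> c = prover diameter_scheme G k -> b).
Proof.
move=> k0; case: n G s => [|[|n]] G s sG; last exact: machine_correct.
  by exists false; [exists 1 | split=> // /diameter_geq_small[]].
by exists false; [exists 1 | split=> // /diameter_geq_small[]].
Qed.

(** * Bounds on the certificate and the space *)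

Lemma log2_gt0 n : (0 < log2 n) = (1 < n).
Proof. by rewrite trunc_log_gt0. Qed.

Lemma size_certificate n (G : sgraph n) k :
  size (prover diameter_scheme G k) <= 2 * (n * log2 k).
Proof.
case: n G => [|[|n]] G //=; rewrite /certificate; case: ifP => // K1.
case: pickP => // u _; rewrite size_mkseq mulnCA leq_mul2l /= /width.
(* The factor 2 absorbs the [.+1] of [width]: the threshold exceeds 1, so its [log2] is at least
   1. *)
have : log2 (threshold n.+2 k) <= log2 k by apply: leq_trunc_log; apply: geq_minl.
have := log2_gt0 (threshold n.+2 k); lia.
Qed.

Lemma card_state n : #|state n| =
  2 + (n.+1.*2).+1 ^ 3 * n.+1 ^ 2 * (n.+1.*2).+1 ^ 2 * 8.
Proof. by rewrite card_sum !card_prod !card_ord card_bool; lia. Qed.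

Lemma space_scheme n : space (verif diameter_scheme n) <= 23 * log2 n.
Proof.
case: n => [|[|n]]; rewrite /space /= ?card_unit //.
set L := log2 _; have L0 : 0 < L by rewrite log2_gt0.
have nL : n.+2 < 2 ^ L.+1 by apply: trunc_log_ltn.
apply: up_log_min => //; rewrite card_state.
have wL : (n.+2.*2).+1 <= 2 ^ L.+2 by rewrite expnS; lia.
apply: leq_trans (_ : 2 + (2 ^ L.+2) ^ 3 * (2 ^ L.+1) ^ 2 * (2 ^ L.+2) ^ 2 * 2 ^ 3 <= _).
  by rewrite leq_add2l !leq_mul ?leq_exp2r //; apply: ltnW.
rewrite -!expnM -!expnD.
(* The outer [.+1] absorbs the two answer states. The exponent is [7L + 16], at most [23L] because
   [L] is positive. *)
apply: leq_trans (_ : 2 ^ (L.+2 * 3 + L.+1 * 2 + L.+2 * 2 + 3).+1 <= _); last first.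
  by rewrite leq_exp2l //; lia.
by rewrite expnS mul2n -addnn leq_add2r addn3 expnS; have := expn_gt0 2; lia.
Qed.

Theorem theorem12 :
  exists S : scheme,
    [/\ certification_scheme diameter_geq S,
        exists C : nat, forall (n : nat) (G : sgraph n) (k : nat),
          0 < k -> size (prover S G k) <= C * (n * log2 k)
      & exists C : nat, forall n : nat,
          space (verif S n) <= C * log2 n].
Proof.
exists diameter_scheme; split.
- split=> n G k.
  + by move=> c s k0 sG; have [[] Y _] := scheme_correct c k0 sG; [left | right].
  + move=> k0 PG s sG; set c := prover _ _ _.
    by have [[] // Y [_ /(_ PG erefl)]] := scheme_correct c k0 sG.
  + move=> k0 PG c s sG.
    by have [[] // Y [/(_ isT) ?]] := scheme_correct c k0 sG.
- by exists 2 => n G k _; apply: size_certificate.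
- by exists 23; apply: space_scheme.
Qed.
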